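(* Assume the continuum hypothesis (or, more generally, Martin's axiom). Let $G=\mathbb{N}_0*\mathbb{Z}_2$ be the free product semigroup generated by $T$ (only non-negative powers of $T$) and an involution $\sigma$. Let $X=\{0,1\}^G$ with the canonical product probability measure $m$ (fair coin in each coordinate) on its Borel sets, and let $G$ act by $(g(x))^h=x^{hg}$; write $x^e$ for the coordinate of $x$ at the identity. Consider the rule $Q$ with two colours $A$ and $B$: (i) if $Tx$ is coloured $A$, colour $x$ opposite to the colour of $\sigma x$; (ii) if $Tx$ is coloured $B$ and $x^e=0$, colour $x$ the same as $\sigma x$; (iii) if $Tx$ is coloured $B$ and $x^e=1$, colour $x$ opposite to the colour of $\sigma x$ (''opposite'' meaning the other of the two colours). Then there exist a pyramidic subset $X'\subseteq X$ of outer measure one and a colouring $c:X'\to\{A,B\}$ satisfying the rule $Q$ on $X'$, such that $c(T(x))=A$ for every $x\in X'$ and the set $\{x\in X': c(x)=A\}$ has outer measure $1$.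
   Context: The semigroup orbit of $x$ is $\{U(x): U \text{ a semigroup word in } T,\sigma\}$. A subset $Y\subseteq X$ is pyramidic if for every $x\in Y$ the semigroup orbit of $x$ is contained in $Y$ (so $Tx,\sigma x\in X'$ whenever $x\in X'$). The outer measure of $Y\subseteq X$ is $m^*(Y)=\inf\{m(L): Y\subseteq L,\ L \text{ open in } X\}$. A colouring $c$ of $X'$ satisfies $Q$ if for every $x\in X'$ the colour $c(x)$ obeys clauses (i)–(iii) with respect to $c(Tx)$, $c(\sigma x)$ and $x^e$. *)

(* Defs.v *)
From HB Require Import structures.
From mathcomp Require Import all_boot all_order all_algebra finmap.
From mathcomp Require Import all_classical all_reals all_analysis.
From mathcomp Require Import lra.

Set Implicit Arguments.
Unset Strict Implicit.
Unset Printing Implicit Defensive.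

Import Order.TTheory GRing.Theory Num.Theory.
Import numFieldNormedType.Exports.

Local Open Scope classical_set_scope.

(** ** The free product [N_0 * Z_2]

    Elements are represented by their normal forms: words in the letters
    [false] (the generator [T]) and [true] (the involution [sigma]) without two
    consecutive [true].  [free_product_universal] below is the universal
    property of the free product of [N_0] and [Z_2] in the category of
    monoids. *)

Definition reduced : pred (seq bool) := sorted (fun a b => ~~ (a && b)).

Definition push (a : bool) (w : seq bool) : seq bool :=
  if a && head false w then behead w else a :: w.

Lemma push_reduced a w : reduced w -> reduced (push a w).
Proof.
rewrite /push; case: w => [|b w] /=; first by rewrite andbF.
by case: a; case: b => //= /path_sorted.
Qed.

Lemma pushK w : reduced w -> push true (push true w) = w.
Proof. by case: w => [//|[] [|[] w]]. Qed.

Definition mulw (u v : seq bool) : seq bool := foldr push v u.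

Lemma mulw_reduced u v : reduced v -> reduced (mulw u v).
Proof. by move=> rv; elim: u => //= a u; exact: push_reduced. Qed.

Lemma mulw_push a u v : reduced v -> mulw (push a u) v = push a (mulw u v).
Proof.
rewrite /push; case: ifP => //; case: a => //=; case: u => //= -[] // u _ rv.
by rewrite -/(push true _) -/(push true _) pushK// mulw_reduced.
Qed.

Lemma mulwA u v w : reduced w -> mulw u (mulw v w) = mulw (mulw u v) w.
Proof. by move=> rw; elim: u => //= a u ->; rewrite mulw_push. Qed.

Lemma mulw0 u : reduced u -> mulw u [::] = u.
Proof.
elim: u => //= a u IH rau; rewrite IH; last exact: path_sorted rau.
by case: u rau {IH} => [|b u] /=; rewrite /push /= ?andbF// => /andP[/negbTE->].
Qed.

Record NZ2 := MkNZ2 { word : seq bool; wordP : reduced word }.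

HB.instance Definition _ := [isSub for word].
HB.instance Definition _ := [Countable of NZ2 by <:].

Definition mulNZ2 (g h : NZ2) : NZ2 :=
  MkNZ2 (mulw_reduced (word g) (wordP h)).
Definition oneNZ2 : NZ2 := @MkNZ2 [::] isT.

Lemma mulNZ2A : associative mulNZ2.
Proof. by move=> f g h; apply: val_inj; exact: mulwA (wordP h). Qed.
Lemma mul1NZ2 : left_id oneNZ2 mulNZ2.
Proof. by move=> g; exact: val_inj. Qed.
Lemma mulNZ21 : right_id oneNZ2 mulNZ2.
Proof. by move=> g; apply: val_inj; exact: mulw0 (wordP g). Qed.

HB.instance Definition _ := isMonoid.Build NZ2 mulNZ2A mul1NZ2 mulNZ21.

Definition gT : NZ2 := @MkNZ2 [:: false] isT.
Definition gsigma : NZ2 := @MkNZ2 [:: true] isT.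

Lemma gsigma_invol : (gsigma * gsigma = 1)%g.
Proof. exact: val_inj. Qed.

Lemma NZ2_ind (P : NZ2 -> Prop) :
  P 1%g -> (forall g, P g -> P (gT * g)%g) ->
  (forall g, P g -> P (gsigma * g)%g) -> forall g, P g.
Proof.
move=> P1 PT Ps [w]; elim: w => [|a w IH] rw.
  by rewrite (_ : MkNZ2 rw = 1%g)//; exact: val_inj.
have rw' : reduced w by exact: path_sorted rw.
have E : MkNZ2 rw = ((if a then gsigma else gT) * MkNZ2 rw')%g.
  apply: val_inj; case: a rw => //=; case: w {IH} rw' => //= b w _.
  by rewrite /push /= => /andP[/negbTE->].
by rewrite E; case: a {rw E}; [exact: Ps|exact: PT].
Qed.

Lemma free_product_universal (M : monoidType) (t s : M) : (s * s = 1)%g ->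
  exists! f : NZ2 -> M,
    [/\ f 1%g = 1%g, (forall g h, f (g * h)%g = (f g * f h)%g),
        f gT = t & f gsigma = s].
Proof.
move=> ss; pose l (a : bool) := if a then s else t.
pose F (w : seq bool) : M := foldr (fun a x => (l a * x)%g) 1%g w.
have Fpush a w : F (push a w) = (l a * F w)%g.
  case: a => //; case: w => [|[] w] //=.
  by rewrite /push /= mulgA ss mul1g.
exists (fun g => F (word g)); split; first split => //=.
- move=> [u ru] [v rv] /=; elim: u {ru} => [|a u IH] /=; first by rewrite mul1g.
  by rewrite -[LHS]/(F (push a (mulw u v))) Fpush IH mulgA.
- by rewrite mulg1.
- by rewrite mulg1.
move=> f [f1 fM fT fs]; apply/funext; elim/NZ2_ind => [|g IH|g IH].
- by rewrite f1.
- by rewrite fM fT -IH -[LHS]/(F (push false (word g))) Fpush.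
- by rewrite fM fs -IH -[LHS]/(F (push true (word g))) Fpush.
Qed.

(** ** The space [X = {0,1}^G] and the action of [G] *)

Definition X : Type := prod_topology (fun _ : NZ2 => bool).

HB.instance Definition _ := Pointed.on X.
HB.instance Definition _ := Nbhs.on X.
HB.instance Definition _ := Topological.on X.

Definition borelX := g_sigma_algebraType (@open X).
HB.instance Definition _ := Measurable.on borelX.

Definition act (g : NZ2) (x : X) : X := fun h => x (h * g)%g.

Definition T : X -> X := act gT.
Definition sigma : X -> X := act gsigma.

Lemma act1 x : act 1%g x = x.
Proof. by apply/funext => h; rewrite /act mulg1. Qed.

Lemma actM g h x : act (g * h)%g x = act g (act h x).
Proof. by apply/funext => k; rewrite /act mulgA. Qed.

Definition orbit (x : X) : set X := range (fun g => act g x).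

Definition pyramidic (Y : set X) : Prop := forall x, Y x -> orbit x `<=` Y.

(** ** The product measure and the outer measure *)

(* Finite-dimensional rectangles are open and closed and generate the Borel
   sets of [X], so that this determines [m]. *)
Definition is_product_measure (R : realType) (mu : probability bool R)
    (m : probability borelX R) : Prop :=
  forall (s : {fset NZ2}) (A : NZ2 -> set bool),
    m [set x : X | forall g, g \in s -> A g (x g)] = (\prod_(g <- s) mu (A g))%E.

Definition fair_coin (R : realType) : probability bool R :=
  bernoulli_prob (2^-1 : R)%R.

Definition cylinder (N : nat) (x : X) : set X :=
  [set y | forall g, (choice.pickle g < N)%N -> y g = x g].

Lemma open_cylinder (L : set X) (x : X) : open L -> L x ->
  exists N, cylinder N x `<=` L.
Proof.
move=> oL Lx; apply: contrapT => /forallNP noN.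
have /choice[u uP] N : exists y, cylinder N x y /\ ~ L y.
  by have /existsNP[y /not_implyP] := noN N; exists y.
have ux : u @ \oo --> x.
  apply/cvg_sup => g U; rewrite nbhsE => -[V [[W oW <-] Wx] VU].
  exists (choice.pickle g).+1 => //= n /= gn; apply: VU.
  by rewrite /preimage/= /proj; have [/(_ g gn) -> _] := uP n.
have [N _ /(_ N (leqnn N))] := ux L (open_nbhs_nbhs (conj oL Lx)).
by have [] := uP N.
Qed.

Section product_measure_exists.
Context (R : realType).
Local Open Scope ring_scope.

(* [digits] sends a uniform real of [[0, 1[] to the sequence of its binary
   digits, indexed along the enumeration of [NZ2]. *)
Definition level (N : nat) (u : R) : nat := Num.truncn (u * 2 ^+ N).
Definition digit (i : nat) (u : R) : bool := odd (level i.+1 u).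
Definition digits (u : R) : borelX := fun g : NZ2 => digit (choice.pickle g) u.

Lemma level_half N u : 0 <= u -> (level N.+1 u)./2 = level N u.
Proof.
move=> u0; apply/esym/truncn_def.
have v0 : 0 <= u * 2 ^+ N by rewrite mulr_ge0// exprn_ge0.
have := @truncn_itv R (u * 2 ^+ N.+1); rewrite -/(level N.+1 u).
rewrite exprS mulrCA; set v := u * _ in v0 *; set n := level _ _.
move=> /(_ (mulr_ge0 (ler0n _ 2) v0)).
rewrite -[X in X%:R <= _]odd_double_half -[X in _ < X.+1%:R]odd_double_half.
rewrite -!natr1 -muln2 natrD natrM.
have [|] : (odd n)%:R = 0 :> R \/ (odd n)%:R = 1 :> R by case: odd; [right|left].
all: move=> -> /andP[H1 H2]; apply/andP; split; lra.
Qed.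

Lemma measurable_level N k : measurable [set u | level N u = k].
Proof.
have p0 : 0 < 2 ^+ N :> R by rewrite exprn_gt0.
case: k => [|k].
  rewrite (_ : [set _ | _] = `]-oo, (2 ^+ N)^-1[%classic)//.
  apply/seteqP; split => u /=; rewrite in_itv/= -[_^-1]mul1r ltr_pdivlMr//.
    by move/truncn0Pn; rewrite -ltNge.
  by move=> h; apply/truncn0Pn; rewrite -ltNge.
rewrite (_ : [set _ | _] = `[k.+1%:R / 2 ^+ N, k.+2%:R / 2 ^+ N[%classic)//.
apply/seteqP; split => u /=; rewrite in_itv/= ler_pdivrMr// ltr_pdivlMr//.
  rewrite /level => uk; rewrite -[X in X%:R <= _]uk -[X in _ < X.+1%:R]uk.
  by apply: truncn_itv; apply/ltW/(lt_le_trans ltr01); rewrite -truncn_gt0 uk.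
exact: truncn_def.
Qed.

Lemma measurable_digit i (B : set bool) : measurable [set u | B (digit i u)].
Proof.
rewrite (_ : [set _ | _] =
    \bigcup_(k in [set k | B (odd k)]) [set u | level i.+1 u = k]).
  by apply: bigcup_measurable => k _; exact: measurable_level.
apply/seteqP; split => u /= => [Bu|[k Bk uk]]; first by exists (level i.+1 u).
by rewrite /digit uk.
Qed.

Lemma measurable_digits : measurable_fun setT digits.
Proof.
apply: (@measurability _ _ R borelX setT digits (@open X)) => // _ [L oL <-].
rewrite setTI.
pose K N (w : {ffun 'I_N -> bool}) :=
  [set x : X | forall g (gN : (choice.pickle g < N)%N), x g = w (Ordinal gN)].
pose E N (w : {ffun 'I_N -> bool}) := [set u | forall i : 'I_N, digit i u = w i].
rewrite (_ : _ @^-1` _ =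
    \bigcup_N \bigcup_(w in [set w | K N w `<=` L]) E N w).
  apply: bigcup_measurable => N _; apply: fin_bigcup_measurable => // w _.
  rewrite (_ : E N w = \bigcap_(i in [set: 'I_N]) [set u | digit i u = w i]).
    apply: fin_bigcap_measurable => // i _.
    exact: (measurable_digit i [set w i]).
  by apply/seteqP; split => u h i => [_|]; apply: h.
apply/seteqP; split => u.
  move=> /(open_cylinder oL)[N NL]; exists N => //.
  exists [ffun i : 'I_N => digit i u] => [x /= Kx|i]; last by rewrite ffunE.
  by apply: NL => g gN; rewrite (Kx g gN) ffunE.
move=> [N _ [w /= wL Ew]]; apply: wL => g gN.
by rewrite -(Ew (Ordinal gN)).
Qed.

Let I01 : set R := `[0, 1[%classic.
Let mI01 : measurable I01. Proof. exact: measurable_itv. Qed.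
Let mu : {measure set _ -> \bar R} := mrestr (@lebesgue_measure R) mI01.

Lemma mu_level N k : (k < 2 ^ N)%N -> mu [set u | level N u = k] = (2 ^- N)%:E.
Proof.
move=> kN; have p0 : 0 < 2 ^+ N :> R by rewrite exprn_gt0.
rewrite /mu /= /mrestr.
rewrite (_ : _ `&` _ = `[k%:R / 2 ^+ N, k.+1%:R / 2 ^+ N[%classic).
  rewrite lebesgue_measure_itv/= lte_fin ltr_pM2r ?invr_gt0// ltr_nat ltnSn.
  by rewrite -EFinB -mulrBl -natr1 addrAC subrr add0r mul1r.
apply/seteqP; split => u /=; rewrite /I01/= !in_itv/= ler_pdivrMr// ltr_pdivlMr//.
  by move=> [<- /andP[u0 _]]; apply: truncn_itv; rewrite mulr_ge0// ltW.
move=> ku; split; first exact: truncn_def.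
case/andP: ku => k1 k2; apply/andP; split.
  by rewrite -(pmulr_lge0 u p0); apply: le_trans k1.
rewrite -(ltr_pM2r p0) mul1r (lt_le_trans k2)//.
by rewrite -natrX ler_nat.
Qed.

Lemma eq_mu (A B : set R) : (forall u, 0 <= u < 1 -> A u <-> B u) -> mu A = mu B.
Proof.
move=> AB; rewrite /mu /= /mrestr; congr (_ _).
apply/seteqP; split => u [Au]; rewrite /I01/= in_itv/= => u01.
all: by split => //; exact/AB.
Qed.

Lemma mu_rect n : forall N k (A : nat -> set bool), (k < 2 ^ N)%N ->
  mu [set u | level N u = k /\ forall i, (i < n)%N -> A i (digit (N + i) u)] =
  ((2 ^- N)%:E * \prod_(i < n) fair_coin R (A i))%E.
Proof.
elim: n => [|n IH] N k A kN.
  rewrite big_ord0 mule1 -(mu_level kN); congr (mu _).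
  by apply/seteqP; split => u //= -[].
pose F (b : bool) := [set u | level N.+1 u = (b + k.*2)%N /\
  forall i, (i < n)%N -> A i.+1 (digit (N.+1 + i) u)].
pose G (b : bool) := if b \in A 0%N then F b else set0.
have mF b : measurable (F b).
  have -> : F b = [set u | level N.+1 u = (b + k.*2)%N] `&`
      \bigcap_(i in `I_n) [set u | A i.+1 (digit (N.+1 + i) u)].
    by apply/seteqP; split => u [].
  apply: measurableI; first exact: measurable_level.
  by apply: fin_bigcap_measurable => // i _; exact: measurable_digit.
have mG b : measurable (G b) by rewrite /G; case: ifP.
have bk (b : bool) : (b + k.*2 < 2 ^ N.+1)%N.
  rewrite expnS mul2n; apply: (@leq_ltn_trans k.*2.+1); last by rewrite ltn_Sdouble.
  by rewrite -add1n leq_add2r leq_b1.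
rewrite (_ : mu _ = mu (G true `|` G false)); last first.
  apply: eq_mu => u /andP[u0 _]; have Hl := level_half N u0; rewrite /G.
  have Ed : digit N u = odd (level N.+1 u) by [].
  split.
    move=> [uk uA]; have := uA 0%N isT; rewrite addn0 => A0.
    have FU : F (digit N u) u.
      split; first by rewrite Ed -uk -Hl odd_double_half.
      by move=> i ni; rewrite addSnnS; exact: uA.
    move/mem_set : A0; case: (digit N u) FU => FU A0; [left|right]; by rewrite A0.
  suff key b : (if b \in A 0%N then F b else set0) u ->
      level N u = k /\ (forall i, (i < n.+1)%N -> A i (digit (N + i) u)).
    by case; exact: key.
  case: ifP => // /set_mem bA [Fb Fr]; split.
    by rewrite -Hl Fb halfD odd_double andbF add0n doubleK; case: (b).
  case=> [_|i]; last by rewrite -addSnnS; exact: Fr.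
  by rewrite addn0 Ed Fb oddD odd_double addbF; case: (b) bA.
transitivity (mu (G true) + mu (G false))%E.
  apply: measureU; [exact: mG|exact: mG|]; apply/seteqP; split => // u []; rewrite /G.
  by case: ifP => // _ [E1 _]; case: ifP => // _ [/eqP]; rewrite E1 eqn_add2r.
have muG b : mu (G b) = (\d_b (A 0%N) * ((2 ^- N.+1)%:E * \prod_(i < n) fair_coin R (A i.+1)))%E.
  rewrite /G diracE; case: ifP => _; last by rewrite measure0 mul0e.
  by rewrite mul1e (IH N.+1 _ (fun i => A i.+1)).
rewrite !muG big_ord_recl /fair_coin/= bernoulli_probE; last by apply/andP; split; lra.
set P := (\prod_(i < n) _)%E.
have P0 : (0 <= P)%E by apply: prode_ge0.
have -> : unstable.onem (2^-1 : R) = 2^-1 by rewrite /unstable.onem; lra.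
rewrite -ge0_muleDl// -ge0_muleDr// exprS invfM EFinM.
by rewrite -!muleA muleCA [RHS]muleCA; congr (_ * _)%E; rewrite muleCA.
Qed.


Lemma image_probability d d' (U : measurableType d) (V : measurableType d')
    (nu : {measure set U -> \bar R}) (f : U -> V) :
  nu setT = 1%E -> measurable_fun setT f ->
  exists P : probability V R, forall C, P C = nu (f @^-1` C).
Proof.
move=> nuT mf.
pose Y : {mfun U >-> V} := HB.pack f (isMeasurableFun.Build _ _ _ _ f mf).
exists (distribution (mnormalize nu (dirac point)) Y) => C.
rewrite /= /distribution /pushforward /= /mnormalize nuT eqe oner_eq0/=.
by rewrite invr1 mule1.
Qed.

Lemma product_measure_exists :
  exists m : probability borelX R, is_product_measure (fair_coin R) m.
Proof.
have muT : mu setT = 1%E.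
  by rewrite /mu/= /mrestr setTI lebesgue_measure_itv/= lte_fin ltr01 oppr0 adde0.
have [P PE] := image_probability muT measurable_digits.
exists P => s A.
pose N := (\max_(g <- s) (choice.pickle g).+1)%N.
have sN g : g \in s -> (choice.pickle g < N)%N.
  by move=> gs; rewrite /N (big_rem g)//= leq_maxl.
pose B i := if choice.pickle_inv i is Some g then
  if g \in s then A g else setT else setT.
have BE g : g \in s -> B (choice.pickle g) = A g.
  by move=> gs; rewrite /B pickleK_inv gs.
have BT i : i \notin map choice.pickle s -> B i = setT.
  rewrite /B; case E : (choice.pickle_inv i) => [g|]//.
  case: ifP => // gs /negP[]; apply/mapP; exists g => //.
  by have := @choice.pickle_invK NZ2 i; rewrite E.
rewrite PE.
transitivity (\prod_(i < N) fair_coin R (B i))%E.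
  transitivity (mu [set u | level 0 u = 0%N /\
      forall i, (i < N)%N -> B i (digit (0 + i) u)]).
    apply: eq_mu => u /andP[u0 u1]; split => [h|[_ h] g gs].
      split; first by apply/truncn0Pn; rewrite expr0 mulr1 -ltNge.
      move=> i _; rewrite add0n.
      have [/mapP[g gs ->]|/BT->//] := boolP (i \in map choice.pickle s).
      by rewrite BE//; exact: h.
    by have := h _ (sN g gs); rewrite BE.
  by rewrite mu_rect// expr0 invr1 mul1e.
rewrite -(big_mkord xpredT (fun i => fair_coin R (B i))).
rewrite (bigID (fun i => i \in map choice.pickle s))/= [X in (_ * X)%E]big1 ?mule1; last first.
  by move=> i /BT ->; exact: probability_setT.
rewrite -big_filter (perm_big (map choice.pickle s)).
  by rewrite big_map; apply: eq_big_seq => g gs; rewrite BE.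
apply: uniq_perm; first by rewrite filter_uniq// iota_uniq.
  by rewrite map_inj_uniq ?fset_uniq//; exact: (pcan_inj choice.pickleK).
move=> i; rewrite mem_filter mem_index_iota/= andb_idr//.
by move=> /mapP[g gs ->]; exact: sN.
Qed.
End product_measure_exists.

Definition outer (R : realType) (m : probability borelX R) (Y : set X) : \bar R :=
  ereal_inf [set m L | L in [set L : set X | open L /\ Y `<=` L]].

(** ** The rule [Q] *)

Inductive colour := A | B.

Definition opposite (a : colour) : colour := if a is A then B else A.

(* The colour of a point outside [Y] is irrelevant: for pyramidic [Y] only the
   restriction of [c] to [Y] is mentioned. *)
Definition satisfies_Q (Y : set X) (c : X -> colour) : Prop :=
  forall x, Y x ->
    [/\ c (T x) = A -> c x = opposite (c (sigma x)),
        c (T x) = B -> x 1%g = false -> c x = c (sigma x) &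
        c (T x) = B -> x 1%g = true -> c x = opposite (c (sigma x))].

(** ** The continuum hypothesis and Martin's axiom *)

Local Open Scope card_scope.

Definition continuum_hypothesis : Prop :=
  forall S : set (nat -> bool), countable S \/ S #= [set: nat -> bool].

Section forcing.
Context {d : Order.disp_t} {P : porderType d}.
Local Open Scope order_scope.

Definition compatible (p q : P) : Prop := exists r, r <= p /\ r <= q.

Definition ccc : Prop := forall S : set P,
  (forall p q, S p -> S q -> p <> q -> ~ compatible p q) -> countable S.

Definition order_dense (D : set P) : Prop := forall p, exists2 q, D q & q <= p.

Definition is_filter (F : set P) : Prop :=
  [/\ F !=set0, (forall p q, F p -> p <= q -> F q) &
      (forall p q, F p -> F q -> exists r, [/\ F r, r <= p & r <= q])].

End forcing.
Arguments ccc {d} P.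

(* [~ (c #<= DD)] expresses [|DD| < c], cardinals being linearly ordered. *)
Definition martin_axiom : Prop :=
  forall (d : Order.disp_t) (P : porderType d), [set: P] !=set0 -> ccc P ->
  forall DD : set (set P),
    (forall D, DD D -> order_dense D) ->
    ~ ([set: nat -> bool] #<= DD) ->
    exists2 F : set P, is_filter F & forall D, DD D -> F `&` D !=set0.

(* Main.v *)
Require Import Defs.
From HB Require Import structures.
From mathcomp Require Import all_boot all_order all_algebra finmap.
From mathcomp Require Import all_classical all_reals all_analysis.
From mathcomp Require Import lra.

(* If every [x] in a set [E] generates its orbit freely enough that the points
   [g x], with [x] in [E] and [g] not starting with [sigma], never coincide with
   a point [sigma (h y)] of the same kind, then colouring the former [A] and
   the latter [B] is consistent on the union of the orbits: it gives [A] to [E]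
   and to the image of [T], and opposite colours to [x] and [sigma x].
   Such an [E] meeting every closed set of positive measure is built by
   transfinite recursion of length continuum: a coincidence within one orbit,
   or with the orbit of a given earlier point, only happens on a null set, and
   fewer than continuum many null sets do not cover a closed set of positive
   measure.  Under the continuum hypothesis this is countable additivity; under
   Martin's axiom it is forcing with the closed sets of positive measure
   (random forcing). *)

Set Implicit Arguments.
Unset Strict Implicit.
Unset Printing Implicit Defensive.

Import Order.TTheory GRing.Theory Num.Theory.

Local Open Scope classical_set_scope.

(** * Normal forms in the free product *)

Definition gTn (n : nat) : NZ2 := iter n (fun g => gT * g)%g 1%g.

Lemma word_gTn_mul n g : word (gTn n * g)%g = nseq n false ++ word g.
Proof.
elim: n => [|n IH]; first by rewrite [X in word X]mul1g.
by rewrite -[gTn n.+1]/(gT * gTn n)%g -mulgA -[RHS]/(push false (nseq n false ++ _)) -IH.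
Qed.

(** The default [false] of [head] lets the identity count as sigma-free, so exactly one of [g] and
    [gsigma * g] is. *)
Definition sigma_free (g : NZ2) : Prop := head false (word g) = false.

Lemma word_gsigma_mul g : sigma_free g ->
  word (gsigma * g)%g = true :: word g.
Proof. by case: g => -[|[] w] rw. Qed.

Lemma gsigmaK g : (gsigma * (gsigma * g) = g)%g.
Proof. by rewrite mulgA gsigma_invol mul1g. Qed.

Lemma sigmaK : involutive sigma.
Proof. by move=> x; rewrite /sigma -actM gsigma_invol act1. Qed.

Lemma split_gsigma g : head false (word g) ->
  exists2 h, sigma_free h & g = (gsigma * h)%g.
Proof.
case: g => -[//|[] w] //= rw _; have rw' : reduced w by exact: path_sorted rw.
have hw : head false w = false by case: w rw {rw'} => //= b w /andP[/negbTE].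
by exists (MkNZ2 rw') => //; apply: val_inj; rewrite [RHS]word_gsigma_mul.
Qed.

(** * Finite-dimensional cylinders and null sets *)

Definition rect (I : finType) (f : I -> NZ2) (w : I -> bool) : set X :=
  [set x | forall i, x (f i) = w i].

Lemma open_rect (I : finType) (f : I -> NZ2) (w : I -> bool) : open (rect f w).
Proof.
rewrite openE => x xw.
have : \forall y \near x, forall i, y (f i) = w i; last by [].
apply: (@filter_forall _ I (fun i => [set y : X | y (f i) = w i]) (nbhs x)) => i.
have : open ((fun x : X => x (f i)) @^-1` [set w i]).
  by apply: open_comp => [y _|]; [exact: proj_continuous|exact: discrete_open].
by rewrite openE; apply.
Qed.

Section null.
Context (R : realType) (m : probability borelX R).

Lemma measurable_open (U : set X) : open U -> measurable (U : set borelX).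
Proof. exact: sub_sigma_algebra. Qed.

Hypothesis mP : is_product_measure (fair_coin R) m.

Lemma measure_rect (I : finType) (f : I -> NZ2) (w : I -> bool) : injective f ->
  m (rect f w) = ((2^-1)^+ #|I|)%:E.
Proof.
move=> f_inj; pose s := [fset f i | i in I]%fset.
(* Quantifying over the indices sent to [g] avoids inverting [f]; injectivity makes [A (f i)] the
   singleton of [w i]. *)
pose A g := [set b | forall i, f i = g -> b = w i].
transitivity (m [set x : X | forall g, g \in s -> A g (x g)]).
  congr (m _); apply/seteqP; split => x.
    by move=> xw g /imfsetP[i _ ->] j /f_inj ->.
  by move=> xs i; apply: (xs (f i)) => //; apply/imfsetP; exists i.
rewrite mP (perm_big (map f (enum I))); last first.
  apply: uniq_perm; [exact: fset_uniq|by rewrite map_inj_uniq ?enum_uniq|].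
  move=> g; apply/imfsetP/mapP => -[i Hi ->]; exists i => //; first by rewrite mem_enum.
rewrite big_map big_enum/= (eq_bigr (fun=> (2^-1)%:E)) => [|i _].
  by rewrite prodEFin prodr_const.
rewrite (_ : A (f i) = [set w i]); last first.
  by apply/seteqP; split => [b|b -> j /f_inj ->//]; exact.
rewrite /fair_coin bernoulli_probE; last by apply/andP; split; lra.
have E b : (b \in [set w i]) = (b == w i) by apply/idP/eqP => [/set_mem|/mem_set].
rewrite !diracE !E; case: (w i); rewrite /= ?(mule0, mule1, adde0, add0e)//.
by congr EFin; rewrite /unstable.onem; lra.
Qed.

Definition null (N : set X) : Prop :=
  forall e : R, (0 < e)%R -> exists U, [/\ open U, N `<=` U & (m U <= e%:E)%E].

Lemma null_half_pow (N : set X) :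
  (forall n, exists U, [/\ open U, N `<=` U & (m U <= ((2^-1) ^+ n)%:E)%E]) ->
  null N.
Proof.
move=> H e e0; have [n ne] : exists n, ((2^-1) ^+ n <= e)%R.
  have /cvg_expr/cvgrPdist_le/(_ e e0)[n _ /(_ n (leqnn n))] : (`|2^-1 : R| < 1)%R.
    by rewrite ger0_norm; lra.
  by rewrite sub0r normrN ger0_norm ?exprn_ge0//; exists n.
have [U [oU NU mU]] := H n; exists U; split => //.
by rewrite (le_trans mU)// lee_fin.
Qed.

Lemma null_bigcup (I : Type) (D : set I) (N : I -> set X) :
  countable D -> (forall i, D i -> null (N i)) -> null (\bigcup_(i in D) N i).
Proof.
move=> /pcard_injP[f f_inj] nN e e0.
pose M n := \bigcup_(i in [set i | D i /\ f i = n]) N i.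
have /choice[U UP] n : exists U, [/\ open U, M n `<=` U &
    (m U <= (e / (2 ^ n.+1)%:R)%:E)%E].
  have e1 : (0 < e / (2 ^ n.+1)%:R)%R by rewrite divr_gt0// ltr0n expn_gt0.
  have [[i [Di fi]]|noi] := pselect (exists i, D i /\ f i = n).
    have [U [oU NU mU]] := nN i Di _ e1; exists U; split => // x [j [Dj fj] Nx].
    by apply: NU; rewrite (f_inj i j) ?inE// fi.
  exists set0; split; [exact: open0| |by rewrite measure0 lee_fin ltW].
  by move=> x [i ? _]; apply: noi; exists i.
exists (\bigcup_n U n); split.
- by apply: bigcup_open => n _; have [] := UP n.
- move=> x [i Di Nx]; exists (f i) => //.
  by have [_ + _] := UP (f i); apply; exists i.
- have oU n : open (U n) by have [] := UP n.
  have mU n : measurable (U n : set borelX) by exact: measurable_open.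
  have mUU : measurable (\bigcup_n U n : set borelX) by exact: bigcup_measurable.
  apply: (le_trans (generalized_Boole_inequality m mU mUU)).
  apply: le_trans (epsilon_trick0 xpredT (ltW e0)).
  by apply: lee_nneseries => // n _; have [] := UP n.
Qed.

(** The equation prescribes the coordinates [gTn i * g] of [x]. These are distinct because [T] never
    cancels, so [n] of them cost a factor [2^-n]. *)
Lemma null_act_eq (g : NZ2) (y : X) : null [set x | act g x = y].
Proof.
apply: null_half_pow => n; pose f (i : 'I_n) := (gTn i * g)%g.
exists (rect f (fun i => y (gTn i))); split => [|x <- i //|]; first exact: open_rect.
rewrite measure_rect ?card_ord// => i j /(congr1 (fun k => size (word k))).
rewrite !word_gTn_mul !size_cat !size_nseq => /addIn; exact: val_inj.
Qed.

(* Spacing the exponents by a bound on the lengths of [g] and [h] makes all the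
   coordinates [T^(i M) g] and [T^(i M) h] distinct, hence the equations
   between them independent. *)
Lemma null_act_coincide (g h : NZ2) : word g <> word h ->
  null [set x | act g x = act h x].
Proof.
move=> gh; pose M := (maxn (size (word g)) (size (word h))).+1.
pose k (b : bool) := if b then g else h.
have kM b : (size (word (k b)) < M)%N by rewrite /M ltnS leq_max; case: b; rewrite leqnn ?orbT.
apply: null_half_pow => n; pose f (p : 'I_n * bool) := (gTn (p.1 * M) * k p.2)%g.
have f_inj : injective f.
  move=> [i b] [j c] /(congr1 word); rewrite !word_gTn_mul /= => E.
  have ij : i = j.
    apply/val_inj; have /(congr1 (fun w => size w %/ M)%N) := E.
    by rewrite !size_cat !size_nseq !divnMDl// !divn_small ?addn0.
  move: E; rewrite ij => /(congr1 (drop (j * M))).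
  rewrite !drop_size_cat ?size_nseq// /k.
  by case: b; case: c => // /esym; move/gh || move/esym/gh.
(* [w] lists the common values of the [n] pairs of coordinates: there are [2^n] choices, each of
   measure [4^-n]. *)
pose F (w : {ffun 'I_n -> bool}) := rect f (fun p => w p.1).
have oF w : open (F w) by exact: open_rect.
exists (\bigcup_w F w); split; first by apply: bigcup_open => w _.
  move=> x /= xgh; exists [ffun i => x (f (i, true))] => //= -[i b]; rewrite ffunE.
  by case: b => //; rewrite -[LHS]/(act h x _) -xgh.
have mF w : measurable (F w : set borelX) by exact: measurable_open.
apply: (@le_trans _ _ (\sum_(w <- enum {ffun 'I_n -> bool}) m (F w))%E).
  rewrite fsbig_seq ?enum_uniq//; apply: content_sub_fsum => //.
    by apply: fin_bigcup_measurable => //; exact: finite_finset.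
  by move=> x [w _ Fx]; exists w => //=; rewrite mem_enum.
rewrite big_enum/= (eq_bigr (fun=> ((2^-1) ^+ (n * 2))%:E)) => [|w _]; last first.
  by rewrite measure_rect// card_prod card_ord card_bool.
rewrite sumEFin sumr_const card_ffun card_bool card_ord lee_fin.
rewrite -[leLHS]mulr_natr natrX muln2 -addnn exprD -mulrA -exprMn.
by rewrite mulVf// expr1n mulr1.
Qed.

End null.

(** * Random forcing and small unions of null sets *)

Section forcing.
Context (R : realType) (m : probability borelX R).

Lemma measurable_closed (K : set X) : closed K -> measurable (K : set borelX).
Proof.
move=> cK; rewrite -[K]setCK; apply: (@measurableC _ borelX).
by apply: measurable_open; exact: closed_openC.
Qed.

Lemma closed_avoid_null (K N : set X) : closed K -> (0 < m K)%E -> null m N ->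
  exists K', [/\ closed K', K' `<=` K, (0 < m K')%E & K' `&` N `<=` set0].
Proof.
move=> cK K0 nN.
have fK : m K \is a fin_num by apply: fin_num_measure; exact: measurable_closed.
(* An open cover of [N] of at most half the measure of [K] can be removed from [K]. *)
have r0 : (0 < fine (m K) / 2)%R by rewrite divr_gt0// fine_gt0// K0/= ltey_eq fK.
have [U [oU NU mU]] := nN _ r0.
exists (K `\` U); split.
- by rewrite setDE; apply: closedI => //; exact: open_closedC.
- by move=> x [].
- rewrite lt_neqAle measure_ge0 andbT eq_sym; apply/eqP => KU0.
  have : (m K <= m U)%E.
    rewrite (@measureDI _ _ _ m K U); [|exact: measurable_closed|exact: measurable_open].
    rewrite [X in (X + _)%E]KU0 add0e; apply: le_measure; rewrite ?inE//.
    + by apply: measurableI; [exact: measurable_closed|exact: measurable_open].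
    + exact: measurable_open.
  move=> /le_trans /(_ mU); rewrite -(fineK fK) lee_fin; lra.
- by move=> x [[_ Ux] /NU].
Qed.

Lemma sum_measure_le_bigcup (I : choiceType) (s : seq I) (K : I -> set X) :
  uniq s -> (forall i, closed (K i)) ->
  {in s &, forall i j, i != j -> m (K i `&` K j) = 0%E} ->
  (\sum_(i <- s) m (K i) <= m (\bigcup_(i in [set` s]) K i))%E.
Proof.
move=> + cK; have mK i : measurable (K i : set borelX) by exact: measurable_closed.
elim: s => [|i s IH]; first by rewrite big_nil measure_ge0.
rewrite cons_uniq => /andP[is_ us] dK; rewrite big_cons.
set U := \bigcup_(j in [set` s]) K j in IH *.
have mU : measurable (U : set borelX) by exact: fin_bigcup_measurable.
have -> : \bigcup_(j in [set` i :: s]) K j = K i `|` U.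
  apply/seteqP; split => x => [[j /=]|[Kx|[j /= js Kx]]].
  - by rewrite inE => /orP[/eqP->|js] Kx; [left|right; exists j].
  - by exists i; rewrite //= mem_head.
  - by exists j; rewrite //= inE js orbT.
have UK0 : m (U `&` K i) = 0%E.
  apply/eqP; rewrite -measure_le0.
  apply: (@le_trans _ _ (\sum_(j <- s) m (K i `&` K j))%E).
    rewrite fsbig_seq//; apply: content_sub_fsum => //.
    - by move=> j _; exact: measurableI.
    - exact: measurableI.
    - by move=> x [[j js Kj] Ki]; exists j.
  rewrite big_seq big1// => j js; apply: dK; rewrite ?mem_head ?inE ?js ?orbT//.
  by apply: contraNneq is_ => ->.
have IHs : (\sum_(j <- s) m (K j) <= m U)%E.
  by apply: IH => // j k js ks; apply: dK; rewrite inE ?js ?ks orbT.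
rewrite (@measureDI _ _ _ m (K i `|` U) (K i))//; last exact: measurableU.
rewrite (setIidr (@subsetUl _ _ _)) addeC leeD2r//.
rewrite setDUl setDv set0U (le_trans IHs)//.
rewrite (measureDI m mU (mK i)) [X in (_ + X)%E]UK0 adde0; exact: lexx.
Qed.

Lemma compactX : compact [set: X].
Proof.
have := tychonoff (fun _ : NZ2 => bool_compact).
rewrite (_ : mkset _ = [set: X])//.
by apply/seteqP; split.
Qed.

Variable C : set X.

(** Conditions of random forcing below [C], ordered by inclusion; staying inside [C] puts the point
    given by a filter in [C]. *)
Record closed_positive := ClosedPositive {
  cp_set :> set X;
  cp_closed : closed cp_set;
  cp_sub : cp_set `<=` C;
  cp_gt0 : (0 < m cp_set)%E }.

HB.instance Definition _ := gen_eqMixin closed_positive.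
HB.instance Definition _ := gen_choiceMixin closed_positive.

Let le (p q : closed_positive) : bool := `[< (p : set X) `<=` q >].

Lemma cp_le_refl : reflexive le. Proof. by move=> p; apply/asboolP. Qed.
Lemma cp_le_anti : antisymmetric le.
Proof.
move=> [p cp sp p0] [q cq sq q0] /andP[/asboolP/= pq /asboolP/= qp].
have E : p = q by apply/seteqP.
by case: q / E in cq sq q0 pq qp *; congr ClosedPositive; exact: Prop_irrelevance.
Qed.
Lemma cp_le_trans : transitive le.
Proof.
by move=> q p r /asboolP pq /asboolP qr; apply/asboolP; exact: subset_trans qr.
Qed.
HB.instance Definition _ := Order.Le_isPOrder.Build Order.default_display
  closed_positive cp_le_refl cp_le_anti cp_le_trans.

Lemma cp_leP (p q : closed_positive) : (p <= q)%O <-> (p : set X) `<=` q.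
Proof. by split => [/asboolP|?]; last exact/asboolP. Qed.

(** Incompatible conditions meet in a null set, as otherwise their intersection would be a common
    extension. Total measure 1 then allows at most [n + 1] of them of measure at least [1/(n+1)]. *)
Lemma ccc_closed_positive : ccc closed_positive.
Proof.
move=> S antiS.
have disj p q : S p -> S q -> p != q -> m (p `&` q) = 0%E.
  move=> Sp Sq /eqP pq; apply/eqP; rewrite -measure_le0 leNgt; apply/negP => pq0.
  apply: (antiS p q Sp Sq pq).
  have cpq : closed (p `&` q) by apply: closedI; exact: cp_closed.
  have sC : p `&` q `<=` C by apply: subset_trans (@cp_sub p); exact: subIsetl.
  by exists (ClosedPositive cpq sC pq0); split; apply/cp_leP => x [].
pose Z n := [set p | S p /\ ((n.+1%:R^-1)%:E <= m p)%E].
rewrite (_ : S = \bigcup_n Z n); last first.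
  apply/seteqP; split => [p Sp|p [n _ []//]].
  have fp : m p \is a fin_num.
    by apply: fin_num_measure; apply: measurable_closed; exact: cp_closed.
  have p0 : (0 < fine (m p))%R by rewrite fine_gt0// cp_gt0/= ltey_eq fp.
  have [n np] := @ltr_add_invr R 0 _ p0.
  by exists n => //; split => //; rewrite -(fineK fp) lee_fin ltW// -[X in (X < _)%R]add0r.
apply: bigcup_countable => // n _; apply: finite_set_countable; apply: contrapT.
move=> /(@infinite_set_fset _ _ n.+2)[B BZ Bn].
have /= : (\sum_(p <- B) m p <= 1)%E.
  apply: (@le_trans _ _ (m (\bigcup_(p in [set` (B : seq _)]) p))).
    apply: sum_measure_le_bigcup => // [p|p q pB qB]; first exact: cp_closed.
    by have [Sp _] := BZ p pB; have [Sq _] := BZ q qB; exact: disj.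
  apply: probability_le1; apply: fin_bigcup_measurable => // p _.
  by apply: measurable_closed; exact: cp_closed.
apply/negP; rewrite -ltNge.
have : ((\sum_(p <- B) n.+1%:R^-1)%:E <= \sum_(p <- B) m p)%E.
  rewrite -sumEFin big_seq [leRHS]big_seq; apply: lee_sum => p pB.
  by have [] := BZ p pB.
apply: lt_le_trans; rewrite lte_fin big_const_seq count_predT iter_addr_0.
rewrite -[ltRHS]mulr_natl ltr_pdivlMr ?ltr0n// mul1r ltr_nat.
exact: leq_trans Bn.
Qed.

Hypotheses (cC : closed C) (C0 : (0 < m C)%E).

Lemma closed_positive_avoid_dense (N : set X) : null m N ->
  order_dense [set p : closed_positive | p `&` N `<=` set0].
Proof.
move=> nN p.
have [K [cK Kp K0 KN]] := closed_avoid_null (@cp_closed p) (@cp_gt0 p) nN.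
exists (ClosedPositive cK (subset_trans Kp (@cp_sub p)) K0) => //.
exact/cp_leP.
Qed.

(** Positive measure makes every condition nonempty, so the filter generates a proper filter on a
    compact space; its cluster point lies in each condition by closedness. *)
Lemma filter_closed_positive_inter (F : set closed_positive) : is_filter F ->
  exists x : X, forall p, F p -> (p : set X) x.
Proof.
move=> [[p0 Fp0] _ Fdir].
have FF : ProperFilter (filter_from F (fun p => p : set X)).
  apply: filter_from_proper; last first.
    move=> p _; apply/set0P/eqP => p0'; have := cp_gt0 p.
    by rewrite p0' measure0 ltxx.
  apply: filter_from_filter; first by exists p0.
  move=> p q Fp Fq; have [r [Fr /cp_leP rp /cp_leP rq]] := Fdir p q Fp Fq.
  by exists r => // x rx; split; [exact: rp|exact: rq].
have [|x [_ Fx]] := compactX FF; first by exists p0.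
exists x => p Fp; have := @cp_closed p x; apply; move: Fx; rewrite clusterE; apply.
by exists p.
Qed.

Lemma closed_not_covered (D : set (nat -> bool)) (N : (nat -> bool) -> set X) :
  continuum_hypothesis \/ martin_axiom ->
  ~ ([set: nat -> bool] #<= D)%card -> (forall i, D i -> null m (N i)) ->
  exists2 x, C x & forall i, D i -> ~ N i x.
Proof.
move=> CHMA smallD nN.
(* Countable [D] needs neither axiom, and under the continuum hypothesis no other [D] is small.
   Martin's axiom handles the rest, with one dense set per null set. *)
have [cD|ncD] := pselect (countable D).
  have [K [_ KC K0 KN]] := closed_avoid_null cC C0 (null_bigcup cD nN).
  have /set0P[x Kx] : K != set0.
    by apply/eqP => E; move: K0; rewrite E measure0 ltxx.
  by exists x => [|i Di Nx]; [exact: KC|apply: (KN x); split => //; exists i].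
case: CHMA => [CH|MA].
  by have [//|] := CH D; rewrite card_eq_le => /andP[_ /smallD].
pose dense i := [set p : closed_positive | p `&` N i `<=` set0].
have [|D' [i Di <-]||F filF FD] := MA _ closed_positive _ ccc_closed_positive (dense @` D).
- by exists (ClosedPositive cC (@subset_refl _ C) C0).
- exact: closed_positive_avoid_dense (nN i Di).
- by move=> /card_le_trans /(_ (card_image_le _ _)).
have [x Fx] := filter_closed_positive_inter filF.
exists x => [|i Di Nx].
  by have [[p Fp] _ _] := filF; apply: (@cp_sub p); exact: Fx.
have [p [Fp pN]] := FD (dense i) (ex_intro2 _ _ i Di erefl).
by apply: (pN x); split => //; exact: Fx.
Qed.

End forcing.

(** * Transfinite recursion and cardinality *)

Lemma wf_choice (I : Type) (T : pointedType) (lt : I -> I -> Prop)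
    (Q : I -> (I -> T) -> T -> Prop) :
  well_founded lt ->
  (forall i f, exists x, Q i f x) ->
  (forall i f f' x, (forall j, lt j i -> f j = f' j) -> Q i f x -> Q i f' x) ->
  exists f, forall i, Q i f (f i).
Proof.
move=> lt_wf exQ Qext.
(* Values not yet constructed are filled with [point]; by the locality hypothesis on [Q] they do not
   matter. *)
pose ext i (u : forall j, lt j i -> T) j :=
  if pselect (lt j i) is left h then u j h else point.
have /choice[F FP] (p : I * (I -> T)) : exists x, Q p.1 p.2 x by exact: exQ.
pose f := Fix lt_wf (fun _ => T) (fun i u => F (i, ext i u)).
have fE i : f i = F (i, ext i (fun j _ => f j)).
  rewrite /f Fix_eq// => {}i u v uv; congr (F (i, ext i _)).
  by apply: functional_extensionality_dep => j; apply: functional_extensionality_dep => h.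
exists f => i; rewrite fE; apply: (Qext _ _ _ _ _ (FP (i, ext i (fun j _ => f j)))) => j ji /=.
by rewrite /ext; case: pselect.
Qed.

Section cardinality.
Local Open Scope card_scope.

(** [J] plays the role of the initial ordinal of the cardinality of [T]: the segment below the least
    point whose segment has full size, or all of [T] if there is no such point. *)
Lemma well_founded_small_segments (T : Type) : exists (J : set T) (lt : T -> T -> Prop),
  [/\ well_founded lt, (forall i j, i <> j -> lt i j \/ lt j i),
      [set: T] #<= J &
      forall j, J j -> ~ ([set: T] #<= [set i | J i /\ lt i j])].
Proof.
have [le le_wo] := @wochoice.well_ordering_principle {classic T}.
pose lt (i j : T) : Prop := ~~ le j i.
have minP (A : set T) : A !=set0 -> exists2 a, A a & forall i, A i -> ~ lt i a.
  move=> [a0 Aa0]; have [|a [[Aa amin] _]] := le_wo (fun a => `[< A a >]).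
    by exists a0; exact/asboolP.
  by exists a => [|i Ai]; [exact/asboolP|apply/negP; rewrite negbK amin//; exact/asboolP].
have lt_wf : well_founded lt.
  move=> i; apply: contrapT => nAi.
  have [a nAa amin] := minP [set i | ~ Acc lt i] (ex_intro _ i nAi).
  by apply: nAa; constructor => j ja; apply: contrapT => /amin.
have lt_total i j : i <> j -> lt i j \/ lt j i.
  move=> ij; rewrite /lt; have [ji|_] := boolP (le j i); [right|by left].
  apply/negP => ij'; apply: ij.
  (* Antisymmetry comes from uniqueness of the least element of the pair, and reflexivity from
     singletons. *)
  have [|a [_ aP]] := le_wo (fun k => (k == i :> {classic T}) || (k == j :> {classic T})).
    by exists i; rewrite /in_mem/= eqxx.
  have refl k : le k k.
    have [|b [[/eqP-> ]]] := le_wo (fun l => l == k :> {classic T}).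
      by exists k; rewrite /in_mem/= eqxx.
    by move=> /(_ k); rewrite /in_mem/= eqxx => /(_ isT).
  rewrite -(aP i) ?(aP j)//; split; rewrite /in_mem/= ?eqxx ?orbT// => k /orP[]/eqP->//.
have [[a0 big0]|nobig] := pselect (exists a, [set: T] #<= [set i | lt i a]).
  have [a biga amin] := minP [set a | [set: T] #<= [set i | lt i a]] (ex_intro _ a0 big0).
  exists [set i | lt i a], lt; split => // j ja bigj; apply: (amin j) => //=.
  by apply: card_le_trans bigj _; apply: subset_card_le => i [].
exists setT, lt; split => // j _ bigj; apply: nobig; exists j.
by apply: card_le_trans bigj _; apply: subset_card_le => i [].
Qed.

(** An open set is determined by the basic cylinders it contains, and these are coded by finite bit
    strings. *)
Lemma card_le_open : [set L : set X | open L] #<= [set: nat -> bool].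
Proof.
pose K (w : seq bool) : set X :=
  [set y | forall g, (choice.pickle g < size w)%N -> y g = nth false w (choice.pickle g)].
pose code (L : set X) n :=
  if choice.unpickle n is Some w then `[< K w `<=` L >] else false.
apply/pcard_injP; exists code => L L'; rewrite !inE => oL oL' LL'.
have KL w : K w `<=` L <-> K w `<=` L'.
  have /(congr1 (fun c => c (choice.pickle w))) := LL'.
  by rewrite /code choice.pickleK => E; split => /asboolP; [rewrite E|rewrite -E] => /asboolP.
have sub (M : set X) x : open M -> M x -> exists2 w, K w x & K w `<=` M.
  move=> oM /(open_cylinder oM)[N NM].
  pose w := mkseq (fun i => if choice.pickle_inv i is Some g then x g else false) N.
  have wE g : (choice.pickle g < N)%N -> nth false w (choice.pickle g) = x g.
    by move=> gN; rewrite nth_mkseq// choice.pickleK_inv.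
  exists w => [g|y Ky]; first by rewrite size_mkseq => /wE.
  by apply: NM => g gN; rewrite Ky ?size_mkseq// wE.
apply/seteqP; split => x.
  by move=> /(sub _ _ oL)[w Kx /KL]; exact.
by move=> /(sub _ _ oL')[w Kx /KL]; exact.
Qed.

End cardinality.

(** * Colouring from an independent set *)

Definition independent (E : set X) : Prop := forall x y g h,
  E x -> E y -> sigma_free g -> sigma_free h -> act g x <> act (gsigma * h)%g y.

Lemma colouring_of_independent (E : set X) : independent E ->
  exists (X' : set X) (c : X -> colour),
    [/\ pyramidic X', satisfies_Q X' c, (forall x, X' x -> c (T x) = A) &
        forall x, E x -> X' x /\ c x = A].
Proof.
move=> indepE.
pose S := [set y | exists x g, [/\ E x, sigma_free g & y = act g x]].
pose c y := if pselect (S y) is left _ then A else B.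
have cS y : S y -> c y = A by rewrite /c; case: pselect.
have ncS y : ~ S y -> c y = B by rewrite /c; case: pselect.
exists (\bigcup_(x in E) Defs.orbit x), c.
(* Prepending [T] always gives a sigma-free word, whether or not [g] is one. *)
have cT y : (\bigcup_(x in E) Defs.orbit x) y -> c (T y) = A.
  move=> [x Ex [g _ <-]]; apply: cS; exists x, (gT * g)%g; split => //.
  by rewrite /T actM.
split => //.
- by move=> _ [x Ex [g _ <-]] _ [h _ <-]; exists x => //; exists (h * g)%g; rewrite ?actM.
(* Clauses (ii) and (iii) are vacuous. For (i), exactly one of [y] and [sigma y] is in [S]. *)
- move=> y X'y; rewrite (cT y X'y); split => // _.
  case: X'y => x Ex [g _ <-].
  have [gs|/negbTE gs] := boolP (head false (word g)).
    have [h hs ->] := split_gsigma gs.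
    have Sh : S (act h x) by exists x, h.
    rewrite actM (sigmaK (act h x)) (cS _ Sh) ncS// => -[x' [h' [Ex' h's E']]].
    by apply: (indepE x' x h' h) => //; rewrite actM.
  rewrite cS ?ncS//; last by exists x, g.
  move=> [x' [h [Ex' hs E']]].
  by apply: (indepE x' x h g) => //; rewrite -E' actM.
- move=> x Ex; split; first by exists x => //; exists 1%g; rewrite ?act1.
  by apply: cS; exists x, 1%g; rewrite act1.
Qed.

(** * Recursive construction of an independent set *)

Section generators.
Context (R : realType) (m : probability borelX R).

(** An open superset of measure below 1 would have a closed complement of positive measure missing
    [Y]. *)
Lemma outer_eq1 (Y : set X) :
  (forall K, closed K -> (0 < m K)%E -> Y `&` K !=set0) -> outer m Y = 1%E.
Proof.
move=> YK; apply/eqP; rewrite eq_le; apply/andP; split.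
  apply: ereal_inf_lbound; exists setT; last exact: probability_setT.
  by split => //; exact: openT.
apply: le_ereal_inf_tmp => _ [L [oL YL] <-]; rewrite leNgt; apply/negP => L1.
have [|x [Yx]] := YK (~` L) (open_closedC oL); last by apply; exact: YL.
by rewrite probability_setC ?sube_gt0//; exact: measurable_open.
Qed.

Hypothesis mP : is_product_measure (fair_coin R) m.

Let clash (y : X) : set X := \bigcup_p [set x | act p.1 x = act (gsigma * p.2)%g y].

(** Sigma-freeness keeps [p.1] and [gsigma * p.2] distinct; if they were equal, the equation would
    hold for every [x]. *)
Let self_clash : set X := \bigcup_(p in [set p | sigma_free p.1 /\ sigma_free p.2])
  [set x | act p.1 x = act (gsigma * p.2)%g x].

Lemma null_clash y : null m (clash y).
Proof. by apply: null_bigcup => [|p _]; [exact: countableP|exact: null_act_eq]. Qed.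

Lemma null_self_clash : null m self_clash.
Proof.
apply: null_bigcup => [|[g h] [/= gs hs]]; first exact: countableP.
apply: null_act_coincide => // E; move: gs.
by rewrite /sigma_free E word_gsigma_mul.
Qed.

Lemma exists_independent : continuum_hypothesis \/ martin_axiom ->
  exists2 E, independent E & forall K, closed K -> (0 < m K)%E -> E `&` K !=set0.
Proof.
move=> CHMA.
have [J [lt [lt_wf lt_total J_big J_small]]] := well_founded_small_segments (nat -> bool).
have /pcard_surjP[U U_surj] := card_le_trans card_le_open J_big.
(* [U] reaches every open set but may take other values too; [I] keeps the indices whose complements
   are closed of positive measure. *)
pose I := [set j | [/\ J j, open (U j) & (0 < m (~` U j))%E]].
pose Q i (f : (nat -> bool) -> X) x := I i ->
  [/\ ~ U i x, ~ self_clash x & forall j, I j -> lt j i -> ~ clash (f j) x].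
have [i f|i f f' x ff' Qx Ii|f fP] := @wf_choice _ X lt Q lt_wf.
- have [Ii|nIi] := pselect (I i); last by exists point.
  have [Ji oU U0] := Ii.
  have [K [cK KU K0 Kclash]] := closed_avoid_null (open_closedC oU) U0 null_self_clash.
  have [||x Kx xN] := closed_not_covered (D := [set j | I j /\ lt j i])
      (N := fun j => clash (f j)) cK K0 CHMA.
  + move=> /card_le_trans big; apply: (J_small i Ji); apply: big.
    by apply: subset_card_le => j [[]].
  + by move=> j _; exact: null_clash.
  exists x => _; split; first exact: KU.
    by move=> Nx; exact: (Kclash x).
  by move=> j Ij ji; exact: xN.
- have [Ux Nx fx] := Qx Ii; split => // j Ij ji.
  by rewrite -ff'//; exact: fx.
exists (f @` I) => [_ _ g h [i Ii <-] [j Ij <-] gs hs E|K cK K0].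
  have [Ui Ni fi] := fP i Ii; have [Uj Nj fj] := fP j Ij.
  have [ij|/lt_total[ij|ji]] := pselect (i = j).
  - by subst j; apply: Ni; exists (g, h).
  (* Applying [sigma] to both sides exchanges the roles of the two points, so the later one always
     clashes with the earlier one. *)
  - apply: (fj i Ii ij); exists (h, g) => //=.
    by rewrite [RHS]actM E -actM gsigmaK.
  - by apply: (fi j Ij ji); exists (g, h).
have [j Jj UjK] := U_surj (~` K) (closed_openC cK).
have Ij : I j by split => //; rewrite UjK ?setCK//; exact: closed_openC.
exists (f j); split; first by exists j.
by have [+ _ _] := fP j Ij; rewrite UjK => /contrapT.
Qed.

End generators.

Theorem theorem2 (R : realType) (m : probability borelX R) :
  continuum_hypothesis \/ martin_axiom ->
  is_product_measure (fair_coin R) m ->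
  exists (X' : set X) (c : X -> colour),
    [/\ pyramidic X',
        outer m X' = 1%E,
        satisfies_Q X' c,
        (forall x, X' x -> c (T x) = A) &
        outer m [set x | X' x /\ c x = A] = 1%E].
Proof.
move=> CHMA mP; have [E indepE EK] := exists_independent mP CHMA.
have [X' [c [pX' Qc cT EX']]] := colouring_of_independent indepE.
(* Both sets contain [E], which meets every closed set of positive measure. *)
exists X', c; split => //; apply: outer_eq1 => K cK /(EK K cK)[x [Ex Kx]];
  by exists x; split => //; have [] := EX' x Ex.
Qed.
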